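(* Let $X$ be a periodic graph with period $L=\mathbb{Z}^N$, with vertex representatives $v_0,\dots,v_n$ ($n\ge 1$) of $V/L$ and weights $w_{ij\gamma}$, and let $\hat X$ be the periodic graph obtained from $X$ by contracting $v_0$ and $v_1$ to $\hat v$. Fix all weights of $X$ except $w_{010}=w_{100}$, which varies over the non-negative real values for which $X$ is connected. For a period homomorphism $\rho\colon L\to\mathbb{R}^N$, let $\Phi^{(h)}$ and $\hat\Phi^{(h)}$ be the harmonic realizations of $X$ and $\hat X$ with period homomorphism $\rho$ normalized by $\Phi^{(h)}(v_0)=\hat\Phi^{(h)}(\hat v)=0$. Then there are $W\in\mathbb{R}$, depending neither on $w_{010}$ nor on $\rho$, and $\bm{z}\in\mathbb{R}^N$, not depending on $w_{010}$ (but possibly on $\rho$), such that \[ \Phi^{(h)}(e_{010})=\frac{\bm{z}}{w_{010}+W} \quad\text{and}\quad \mathcal{T}(\hat X,\hat\Phi^{(h)})-\mathcal{T}(X,\Phi^{(h)})=\frac{\bm{z}^{\otimes 2}}{w_{010}+W}. \] Consequently, \[ \mathcal{E}(\hat X,\hat\Phi^{(h)})-\mathcal{E}(X,\Phi^{(h)})=\frac{\|\bm{z}\|^2}{w_{010}+W}=(w_{010}+W)\,\|\Phi^{(h)}(e_{010})\|^2 . \]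
   Context: A weighted graph $X=(V,E,w)$ has a vertex set $V$, a set $E$ of oriented edges, maps $o,t\colon E\to V$ (origin, terminal) and $\iota\colon E\to E$ (orientation reversal) with $\iota^2=\mathrm{id}$, $\iota(e)\ne e$, $o(\iota(e))=t(e)$, and a weight function $w\colon E\to\mathbb{R}_{\ge0}$ with $w\circ\iota=w$. Loops and multiple edges are allowed; parallel edges may be merged by adding their weights. $X$ is connected if the 1-complex formed by all vertices and the positive-weight edges is connected. A periodic graph is an infinite connected weighted graph with an action of $L=\mathbb{Z}^N$ ($N\ge1$) by weight-preserving automorphisms such that $X\to X/L$ is a covering and $X/L=(V/L,E/L)$ is finite. A periodic realization of $X$ is a map $\Phi\colon V\to\mathbb{R}^N$ together with an injective homomorphism $\rho\colon L\to\mathbb{R}^N$ (the period homomorphism) whose image is a lattice in $\mathbb{R}^N$, with $\Phi(\gamma v)=\Phi(v)+\rho(\gamma)$ for all $v\in V$, $\gamma\in L$. For an edge $e$, $\Phi(e):=\Phi(t(e))-\Phi(o(e))$, which descends to $E/L$. The energy is $\mathcal{E}(X,\Phi)=\frac12\sum_{e\in E/L}w(e)\|\Phi(e)\|^2$ and the global tension tensor is $\mathcal{T}(X,\Phi)=\frac12\sum_{e\in E/L}w(e)\Phi(e)^{\otimes2}$, where $\bm{x}^{\otimes2}=\bm{x}\bm{x}^{\mathsf T}$. $\Phi$ is harmonic if it minimizes $\mathcal{E}$ among periodic realizations with the same period homomorphism $\rho$; equivalently $\sum_{o(e)=v}w(e)\Phi(e)=0$ for all $v\in V$. (A harmonic realization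 with given $\rho$ is unique up to translation.) Notation: $v_0,\dots,v_n\in V$ are representatives of $V/L$; $e_{ij\gamma}$ is the edge from $v_i$ to $\gamma v_j$ ($\gamma\in L$), of weight $w_{ij\gamma}\geq 0$ (zero for all but finitely many $(i,j,\gamma)$; $w_{ij,-\gamma}=w_{ji\gamma}$); these edges represent $E/L$. Thus $e_{010}$ joins $v_0$ to $v_1$, and $w_{010}=w_{100}$ is treated as a single variable. Contraction of $v_0$ and $v_1$ to $\hat v$: the periodic graph $\hat X$ with the same edges, weights and $L$-action, in which for every $\gamma\in L$ the vertices $\gamma v_0$ and $\gamma v_1$ are identified to a single vertex $\gamma\hat v$ (so $e_{010}$ becomes a loop, with realization vector $0$). *)

(* Defs.v *)
From Stdlib Require Import Relation_Operators.
From HB Require Import structures.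
From mathcomp Require Import all_boot all_order all_algebra.
From mathcomp Require Import generic_quotient.
From mathcomp Require Import boolp classical_sets functions cardinality fsbigop.
From mathcomp Require Import reals.

Set Implicit Arguments.
Unset Strict Implicit.
Unset Printing Implicit Defensive.

Import Order.TTheory GRing.Theory Num.Theory.
Local Open Scope quotient_scope.
Local Open Scope classical_set_scope.
Local Open Scope ring_scope.

Section Quotient.
Context {T : choiceType} (r : T -> T -> Prop).

(* The quotient of T by the equivalence relation generated by r. *)
Definition gen_rel : rel T := fun x y => `[< clos_refl_sym_trans T r x y >].

Lemma gen_rel_refl : reflexive gen_rel.
Proof. by move=> x; apply/asboolP; apply: rst_refl. Qed.

Lemma gen_rel_sym : symmetric gen_rel.
Proof. by move=> x y; apply/idP/idP => /asboolP h; apply/asboolP; apply: rst_sym. Qed.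

Lemma gen_rel_trans : transitive gen_rel.
Proof.
by move=> y x z /asboolP h1 /asboolP h2; apply/asboolP; apply: rst_trans h1 h2.
Qed.

Definition gen_equiv : equiv_rel T :=
  EquivRel gen_rel gen_rel_refl gen_rel_sym gen_rel_trans.

Definition quot : choiceType := {eq_quot gen_equiv}.

Definition cls (x : T) : quot := \pi_({eq_quot gen_equiv})%qT x.

Definition rep (q : quot) : T := repr (q : {eq_quot gen_equiv}).

Lemma repK (q : quot) : cls (rep q) = q.
Proof. exact: reprK. Qed.

Lemma clsP (x y : T) : cls x = cls y <-> clos_refl_sym_trans T r x y.
Proof.
by split=> [/eqquotP /asboolP // | h]; apply/eqquotP/asboolP.
Qed.

End Quotient.

(* A graph together with an action of Z^N by automorphisms.  The weight function
   is kept separate, so that it can vary on a fixed graph. *)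
Record zgraph (N : nat) := ZGraph {
  vert : choiceType;
  edge : choiceType;
  orig : edge -> vert;
  term : edge -> vert;
  einv : edge -> edge;
  actV : 'cV[int]_N -> vert -> vert;
  actE : 'cV[int]_N -> edge -> edge;
  einvK : forall e, einv (einv e) = e;
  einv_neq : forall e, einv e <> e;
  orig_einv : forall e, orig (einv e) = term e;
  actV0 : forall v, actV 0 v = v;
  actVD : forall a b v, actV (a + b) v = actV a (actV b v);
  actE0 : forall e, actE 0 e = e;
  actED : forall a b e, actE (a + b) e = actE a (actE b e);
  orig_act : forall a e, orig (actE a e) = actV a (orig e);
  term_act : forall a e, term (actE a e) = actV a (term e);
  einv_act : forall a e, einv (actE a e) = actE a (einv e)
}.

Section Periodic.
Context {R : realType} {N : nat}.
Implicit Types (X : zgraph N) (rho : {additive 'cV[int]_N -> 'cV[R]_N}).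

Definition vorb X := quot (fun x y : vert X => exists a, y = actV a x).
Definition eorb X := quot (fun e f : edge X => exists a, f = actE a e).
Definition vcls X (x : vert X) : vorb X := cls _ x.
Definition ecls X (e : edge X) : eorb X := cls _ e.
Definition erep X (q : eorb X) : edge X := rep q.

Definition is_weight X (w : edge X -> R) : Prop :=
  [/\ forall e, 0 <= w e,
      forall e, w (einv e) = w e
    & forall a e, w (actE a e) = w e].

Definition graph_connected X (w : edge X -> R) : Prop :=
  forall x y, clos_refl_trans (vert X)
    (fun a b => exists e, [/\ 0 < w e, orig e = a & term e = b]) x y.

(* X -> X/L is a covering of graphs: the orientation reversal of X/L has no fixed
   edge, and the star of each vertex of X maps bijectively onto the star of its
   image.  (Freeness of the action is not implied by this alone, but it is by the
   existence of a realization with an injective period homomorphism.) *)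
Definition covering X : Prop :=
  (forall e : edge X, ecls (einv e) <> ecls e) /\
  (forall v : vert X,
     set_bij [set e : edge X | orig e = v]
             [set q : eorb X | vcls (orig (erep q)) = vcls v] (@ecls X)).

Definition periodic_graph X (w : edge X -> R) : Prop :=
  [/\ is_weight w, infinite_set [set: vert X], graph_connected w, covering X
    & finite_set [set: vorb X] /\ finite_set [set: eorb X]].

Definition is_lattice (A : set 'cV[R]_N) : Prop :=
  exists2 B : 'M[R]_N, B \in unitmx
    & A = [set B *m map_mx intr c | c in [set: 'cV[int]_N]].

Definition period_hom rho : Prop := injective rho /\ is_lattice (range rho).

Definition realization X rho (Phi : vert X -> 'cV[R]_N) : Prop :=
  period_hom rho /\ forall a v, Phi (actV a v) = Phi v + rho a.

Definition edge_vec X (Phi : vert X -> 'cV[R]_N) (e : edge X) : 'cV[R]_N :=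
  Phi (term e) - Phi (orig e).

(* The Euclidean norm squared; the library norm on matrices is the sup norm. *)
Definition sqnorm (x : 'cV[R]_N) : R := \sum_i x i 0 ^+ 2.

Definition tensor2 (x : 'cV[R]_N) : 'M[R]_N := x *m x^T.

(* Sums over E/L are evaluated at representatives: the summands are L-invariant
   as soon as w is a weight and Phi is a periodic realization. *)
Definition energy X (w : edge X -> R) (Phi : vert X -> 'cV[R]_N) : R :=
  2^-1 * \sum_(q \in [set: eorb X]) w (erep q) * sqnorm (edge_vec Phi (erep q)).

Definition tension X (w : edge X -> R) (Phi : vert X -> 'cV[R]_N) : 'M[R]_N :=
  2^-1 *:
    \sum_(q \in [set: eorb X]) w (erep q) *: tensor2 (edge_vec Phi (erep q)).

Definition harmonic X (w : edge X -> R) rho (Phi : vert X -> 'cV[R]_N) : Prop :=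
  realization rho Phi /\
  forall Psi : vert X -> 'cV[R]_N, realization rho Psi ->
    energy w Phi <= energy w Psi.

End Periodic.

Arguments is_weight {R N} X w.
Arguments graph_connected {R N} X w.
Arguments periodic_graph {R N} X w.
Arguments energy {R N} X w Phi.
Arguments tension {R N} X w Phi.
Arguments harmonic {R N} X w rho Phi.

Section Contraction.
Context {N : nat} (X : zgraph N) (v0 v1 : vert X).

Definition glue (x y : vert X) : Prop :=
  exists a, x = actV a v0 /\ y = actV a v1.

Definition cvert : choiceType := quot glue.
Definition cproj (x : vert X) : cvert := cls glue x.
Definition cactV (a : 'cV[int]_N) (q : cvert) : cvert := cproj (actV a (rep q)).

Lemma cactV_proj a x : cactV a (cproj x) = cproj (actV a x).
Proof.
rewrite /cactV /cproj; apply/clsP.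
have: clos_refl_sym_trans (vert X) glue (rep (cls glue x)) x.
  by apply/clsP; rewrite repK.
move: (rep _) => y; elim=> [u u' [b [-> ->]]|u|u u' _ h|u u' u'' _ h1 _ h2].
- by apply: rst_step; exists (a + b); rewrite !actVD.
- exact: rst_refl.
- exact: rst_sym.
- exact: rst_trans h1 h2.
Qed.

Lemma cactV0 q : cactV 0 q = q.
Proof. by rewrite /cactV actV0 /cproj repK. Qed.

Lemma cactVD a b q : cactV (a + b) q = cactV a (cactV b q).
Proof. 
rewrite -[RHS]/(cactV a (cproj (actV b (rep q)))) cactV_proj.
by rewrite -actVD. Qed.

Lemma corig_act a (e : edge X) :
  cproj (orig (actE a e)) = cactV a (cproj (orig e)).
Proof. by rewrite cactV_proj orig_act. Qed.

Lemma cterm_act a (e : edge X) :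
  cproj (term (actE a e)) = cactV a (cproj (term e)).
Proof. by rewrite cactV_proj term_act. Qed.

Lemma corig_einv (e : edge X) : cproj (orig (einv e)) = cproj (term e).
Proof. by rewrite orig_einv. Qed.

Definition contraction : zgraph N :=
  @ZGraph N cvert (edge X) (fun e => cproj (orig e)) (fun e => cproj (term e))
    (@einv N X) cactV (@actE N X) (@einvK N X) (@einv_neq N X) corig_einv
    cactV0 cactVD (@actE0 N X) (@actED N X) corig_act cterm_act (@einv_act N X).

End Contraction.

(* Main.v *)
(* Write B_w(f,g) = 1/2 sum_e w(e) df(e) dg(e), the sum running over E/L, for
   functions on V whose differences descend to E/L. As w0 is connected, there is an
   L-invariant u with du(e010) = 1 and B_w0(u,f) = c df(e010) for all L-invariant f.
   Changing the weight s of e010 adds (s - w0(e010)) du(e010) df(e010), so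
   B_w(u,f) = (s + W) df(e010) with W = c - w0(e010). Hence the vector
   W dTheta(e010) - B_w'(u,Theta), where w' is w0 with the weight of e010 set to 0,
   is the same for all realizations Theta with period homomorphism rho; it is z,
   and harmonicity of Phi gives z = (s + W) Phi(e010).
   A harmonic realization of the contraction is a realization Psi of X with
   Psi(v0) = Psi(v1). The components of D = Psi - Phi are B_w-orthogonal to every
   L-invariant f with f(v0) = f(v1), and Phi to every L-invariant f; therefore
   T(Psi) - T(Phi) = T(D), with entries B_w(D_i,D_j) = dD_i(e010) B_w(u,D_j). *)
Require Import Defs.
From Stdlib Require Import Relation_Operators.
From mathcomp Require Import all_boot all_order all_algebra.
From mathcomp Require Import boolp classical_sets functions cardinality fsbigop.
From mathcomp Require Import finmap.
From mathcomp Require Import reals.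
From mathcomp Require Import ring lra.

Set Implicit Arguments.
Unset Strict Implicit.
Unset Printing Implicit Defensive.

Import Order.TTheory GRing.Theory Num.Theory.
Local Open Scope classical_set_scope.
Local Open Scope ring_scope.

(** * Orbits of vertices and edges *)

Section Orbits.
Context {N : nat} (X : zgraph N).

Lemma vcls_act a (x : vert X) : vcls (actV a x) = vcls x.
Proof. by apply/clsP/rst_sym/rst_step; exists a. Qed.

Lemma ecls_act a (e : edge X) : ecls (actE a e) = ecls e.
Proof. by apply/clsP/rst_sym/rst_step; exists a. Qed.

Lemma vclsP (x y : vert X) : vcls x = vcls y -> exists a, y = actV a x.
Proof.
move=> /clsP; elim=> {x y} [x y //|x|x y _ [a ->]|x y z _ [a ->] _ [b ->]].
- by exists 0; rewrite actV0.
- by exists (- a); rewrite -actVD addNr actV0.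
- by exists (b + a); rewrite actVD.
Qed.

Lemma eclsP (e f : edge X) : ecls e = ecls f -> exists a, f = actE a e.
Proof.
move=> /clsP; elim=> {e f} [x y //|x|x y _ [a ->]|x y z _ [a ->] _ [b ->]].
- by exists 0; rewrite actE0.
- by exists (- a); rewrite -actED addNr actE0.
- by exists (b + a); rewrite actED.
Qed.

Lemma erep_ecls (e : edge X) : exists a, erep (ecls e) = actE a e.
Proof. by apply: eclsP; rewrite /ecls /erep repK. Qed.

Lemma term_einv (e : edge X) : term (einv e) = orig e.
Proof. by rewrite -orig_einv einvK. Qed.

End Orbits.

(** * The Dirichlet form on [X/L] *)

Section DirichletForm.
Context {R : realType} {N : nat} (X : zgraph N).
Implicit Types (w : edge X -> R) (f g h : vert X -> R).

Definition grad f (e : edge X) : R := f (term e) - f (orig e).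

Definition invariant f : Prop := forall a x, f (actV a x) = f x.

(** This makes [grad f] constant on edge orbits; components of realizations are of this kind. *)
Definition equivariant f : Prop :=
  exists r : 'cV[int]_N -> R, forall a x, f (actV a x) = f x + r a.

Definition dform w f g : R :=
  2^-1 * \sum_(q \in [set: eorb X])
            w (erep q) * (grad f (erep q) * grad g (erep q)).

Lemma invariant_equivariant f : invariant f -> equivariant f.
Proof. by move=> fI; exists (fun=> 0) => a x; rewrite fI addr0. Qed.

Lemma grad_act f a e : equivariant f -> grad f (actE a e) = grad f e.
Proof. by move=> [r fE]; rewrite /grad term_act orig_act !fE; ring. Qed.

Lemma grad_einv f e : grad f (einv e) = - grad f e.
Proof. by rewrite /grad term_einv orig_einv opprB. Qed.

Lemma dformC w f g : dform w f g = dform w g f.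
Proof.
rewrite /dform; congr (_ * _); apply: eq_fsbigr => q _.
by rewrite [grad f _ * _]mulrC.
Qed.

Hypothesis finE : finite_set [set: eorb X].

Lemma dformDZl w f g h (c : R) :
  dform w (fun x => f x + c * h x) g = dform w f g + c * dform w h g.
Proof.
rewrite /dform !fsbig_finite //= !mulr_sumr -big_split /=.
by apply: eq_bigr => q _; rewrite /grad; ring.
Qed.

Lemma dformDZr w f g h (c : R) :
  dform w g (fun x => f x + c * h x) = dform w g f + c * dform w g h.
Proof. by rewrite dformC dformDZl [dform w f g]dformC [dform w h g]dformC. Qed.

Let in_orbits (q : eorb X) : q \in fset_set [set: eorb X].
Proof. by rewrite in_fset_set // in_setT. Qed.

Lemma dform_ge0 w f : (forall e, 0 <= w e) -> 0 <= dform w f f.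
Proof.
move=> w0; rewrite /dform fsbig_finite //= mulr_ge0 ?invr_ge0 //.
by apply: sumr_ge0 => q _; rewrite mulr_ge0 // -expr2 sqr_ge0.
Qed.

(** A vanishing sum of nonnegative terms forces [grad f] to vanish on every edge of positive weight,
    and such edges connect any two vertices. *)
Lemma dform_eq0_const w f : is_weight X w -> graph_connected X w ->
  equivariant f -> dform w f f = 0 -> forall x y, f x = f y.
Proof.
move=> [w0 wV wA] wC fE; rewrite /dform fsbig_finite //= => /eqP.
rewrite mulf_eq0 invr_eq0 pnatr_eq0 /= psumr_eq0; last first.
  by move=> q _; rewrite mulr_ge0 // -expr2 sqr_ge0.
move=> /allP /= H x y; have := wC x y.
elim=> {x y} [a b [e [we <- <-]]|x //|a b c _ -> _ -> //].
have [c ce] := erep_ecls e.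
have := H _ (in_orbits (ecls e)).
rewrite ce wA grad_act // mulf_eq0 gt_eqF //= mulf_eq0 orbb subr_eq0.
by move=> /eqP.
Qed.

(** Only the orbits of [e1] and [einv e1] contribute to the difference. They are distinct and
    contribute equally, which cancels the factor 1/2. *)
Lemma dform_change_weight w w' f g e1 :
  is_weight X w -> is_weight X w' -> equivariant f -> equivariant g ->
  ecls (einv e1) <> ecls e1 ->
  (forall e, ecls e <> ecls e1 -> ecls e <> ecls (einv e1) -> w e = w' e) ->
  dform w f g = dform w' f g + (w e1 - w' e1) * (grad f e1 * grad g e1).
Proof.
move=> [_ wV wA] [_ wV' wA'] fE gE e1V ww'.
pose F q := (w (erep q) - w' (erep q)) * (grad f (erep q) * grad g (erep q)).
have FE e : F (ecls e) = (w e - w' e) * (grad f e * grad g e).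
  by rewrite /F; have [a ->] := erep_ecls e; rewrite wA wA' !grad_act.
suff : 2^-1 * \sum_(q <- fset_set [set: eorb X]) F q
       = (w e1 - w' e1) * (grad f e1 * grad g e1).
  move=> <-; rewrite /dform !fsbig_finite //= -mulrDr -big_split /=.
  by congr (_ * _); apply: eq_bigr => q _; rewrite /F; ring.
rewrite (bigD1_seq (ecls e1)) ?fset_uniq ?in_orbits //=.
rewrite big_mkcond (bigD1_seq (ecls (einv e1))) ?fset_uniq ?in_orbits //=.
have -> : ecls (einv e1) != ecls e1 by apply/eqP.
rewrite big1_seq ?addr0 => [|q /andP[/eqP q2 _]]; last first.
  case: eqP => //= /eqP/eqP q1; rewrite /F ww' ?subrr ?mul0r //.
    by rewrite /ecls /erep repK.
  by rewrite /ecls /erep repK.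
by rewrite !FE wV wV' !grad_einv; field.
Qed.

End DirichletForm.

(** * Poisson's equation on the quotient graph *)

Section Potential.
Context {R : realType} {N : nat} (X : zgraph N) (w : edge X -> R).
Hypothesis finE : finite_set [set: eorb X].
Hypotheses (wW : is_weight X w) (wC : graph_connected X w).
Context (n : nat) (v : 'I_n -> vert X).
Hypothesis hv : bijective (fun i => vcls (v i)).

(* Poisson's equation with a unit source at [y] and a unit sink at [x]; it is
   solvable because the Laplacian of [X/L], shifted by the square of the
   evaluation at [x], is positive definite. *)
Lemma poisson (x y : vert X) : exists u : vert X -> R,
  invariant u /\ forall f, invariant f -> dform w u f = f y - f x.
Proof.
have [k vk kv] := hv; pose kV z := k (vcls z).
pose lift (c : 'rV[R]_n) (z : vert X) := c 0 (kV z).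
have liftI c : invariant (lift c) by move=> a z; rewrite /lift /kV vcls_act.
have liftE f : invariant f -> f = lift (\row_i f (v i)).
  move=> fI; apply/funext => z; rewrite /lift mxE.
  have [a -> //] : exists a, v (kV z) = actV a z.
  by apply: vclsP; rewrite [RHS]kv.
(* Pairing a row [c] with [b q] gives the gradient of [lift c] along [erep q], so [A] is the Gram
   matrix of the Dirichlet form. *)
pose b q : 'rV[R]_n := delta_mx 0 (kV (term (erep q))) - delta_mx 0 (kV (orig (erep q))).
pose d z : 'rV[R]_n := delta_mx 0 (kV z).
have dE c z : (c *m (d z)^T) 0 0 = lift c z.
  by rewrite trmx_delta -colE mxE.
have dE' c z : (d z *m c^T) 0 0 = lift c z.
  by rewrite -dE -[LHS]trace_mx11 -mxtrace_tr trmx_mul trmxK trace_mx11.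
pose A := 2^-1 *: (\sum_(q <- fset_set [set: eorb X])
                     w (erep q) *: ((b q)^T *m b q)).
pose G := A + (d x)^T *m d x.
have GE c c' : (c *m G *m c'^T) 0 0
    = dform w (lift c) (lift c') + lift c x * lift c' x.
  have bE c1 q : (c1 *m (b q)^T) 0 0 = grad (lift c1) (erep q).
    by rewrite linearB /= mulmxBr !mxE /grad -!dE !mxE.
  have rk1 (p : 'rV[R]_n) :
      (c *m (p^T *m p) *m c'^T) 0 0 = (c *m p^T) 0 0 * (c' *m p^T) 0 0.
    rewrite mulmxA -mulmxA -[p *m c'^T]trmxK trmx_mul trmxK.
    by rewrite mxE big_ord1 [_^T _ _]mxE.
  rewrite mulmxDr mulmxDl mxE rk1 !dE; congr (_ + _).
  rewrite /dform fsbig_finite //= -scalemxAr -scalemxAl mxE; congr (_ * _).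
  rewrite mulmx_sumr mulmx_suml summxE; apply: eq_bigr => q _.
  by rewrite -scalemxAr -scalemxAl mxE rk1 !bE.
have const_lift c : dform w (lift c) (lift c) = 0 -> forall z, lift c z = lift c x.
  move=> c0 z; apply: (dform_eq0_const finE wW wC) c0 _ _.
  exact/invariant_equivariant.
(* If [c *m G = 0], then [lift c] has zero energy, hence is constant, and it vanishes at [x]; so
   [c = 0]. *)
have Gu : G \in unitmx.
  rewrite -row_free_unit -kermx_eq0; apply/rowV0P => c /sub_kermxP cG.
  have := GE c c; rewrite cG mul0mx mxE => /esym/eqP.
  rewrite paddr_eq0 -?expr2 ?sqr_ge0 //; last by apply: dform_ge0 => //; case: wW.
  rewrite sqrf_eq0 => /andP[/eqP /const_lift cc /eqP cx].
  apply/rowP => i; rewrite mxE -cx -(cc (v i)) /lift /kV.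
  by rewrite [k _](vk i).
pose e := d y - d x.
pose u := e *m invmx G.
have uE c : dform w (lift u) (lift c) + lift u x * lift c x = lift c y - lift c x.
  by rewrite -GE mulmxKV // mulmxBl mxE dE' [in X in _ + X]mxE dE'.
(* Testing with the constant function 1 kills the Dirichlet term and the right-hand side, leaving
   only the shift term [lift u x]. *)
have ux : lift u x = 0.
  have := uE (const_mx 1).
  have lift1 z : lift (const_mx 1) z = 1 by rewrite /lift mxE.
  rewrite !lift1 subrr mulr1 => <-; rewrite /dform fsbig_finite //= big1 ?mulr0 ?add0r //.
  by move=> q _; rewrite /grad !lift1 subrr !mulr0.
exists (lift u); split=> // f /liftE ->.
by rewrite -uE ux mul0r addr0.
Qed.

End Potential.

(** * Tension, energy and harmonicity by components *)

Lemma tensor2E (R : realType) N (z : 'cV[R]_N) i j :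
  tensor2 z i j = z i 0 * z j 0.
Proof. by rewrite /tensor2 mxE big_ord1 mxE. Qed.

Lemma sqnorm_tensor2 (R : realType) N (z : 'cV[R]_N) : sqnorm z = \tr (tensor2 z).
Proof. by apply: eq_bigr => i _; rewrite tensor2E expr2. Qed.

Section Realizations.
Context {R : realType} {N : nat} (X : zgraph N).
Implicit Types (w : edge X -> R) (Phi : vert X -> 'cV[R]_N)
  (rho : {additive 'cV[int]_N -> 'cV[R]_N}).

Definition component Phi (i : 'I_N) : vert X -> R := fun x => Phi x i 0.

Lemma grad_component Phi i e : grad (component Phi i) e = edge_vec Phi e i 0.
Proof. by rewrite /grad /component /edge_vec !mxE. Qed.

Lemma component_equivariant rho Phi i :
  realization rho Phi -> equivariant (component Phi i).
Proof.
by move=> [_ PhiE]; exists (fun a => rho a i 0) => a x; rewrite /component PhiE mxE.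
Qed.

Hypothesis finE : finite_set [set: eorb X].

Lemma tensionE w Phi i j :
  tension X w Phi i j = dform w (component Phi i) (component Phi j).
Proof.
rewrite /tension /dform !fsbig_finite //= mxE summxE; congr (_ * _).
by apply: eq_bigr => q _; rewrite mxE tensor2E !grad_component.
Qed.

Lemma energyE w Phi : energy X w Phi = \sum_i dform w (component Phi i) (component Phi i).
Proof.
rewrite /energy /dform !fsbig_finite //= -mulr_sumr; congr (_ * _).
under [RHS]eq_bigr => i _ do rewrite fsbig_finite //=.
rewrite exchange_big; apply: eq_bigr => q _; rewrite /sqnorm mulr_sumr.
by apply: eq_bigr => i _; rewrite grad_component.
Qed.

(** First variation: adding [t * f] to the [i]-th coordinate keeps the periods, so the energy,
    quadratic in [t], is minimal at [t = 0] and its linear coefficient vanishes. *)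
Lemma harmonic_dform w rho Phi f i :
  harmonic X w rho Phi -> invariant f -> dform w f (component Phi i) = 0.
Proof.
move=> [[hrho PhiE] Pmin] fI.
set b := dform w f _; set a := dform w f f.
have H t : 0 <= 2 * t * b + t ^+ 2 * a.
  pose Psi x := Phi x + (t * f x) *: delta_mx i 0.
  have cPsi j : j != i -> component Psi j = component Phi j.
    move=> /negPf ji; apply/funext => x.
    by rewrite /component /Psi !mxE ji /= mulr0 addr0.
  have cPsii : component Psi i = fun x => component Phi i x + t * f x.
    by apply/funext => x; rewrite /component /Psi !mxE !eqxx mulr1.
  have /Pmin : realization rho Psi.
    by split=> // c x; rewrite /Psi PhiE fI addrAC.
  rewrite !energyE (bigD1 i) //= [leRHS](bigD1 i) //= cPsii.
  under [X in _ <= _ + X]eq_bigr => j ji do rewrite cPsi //.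
  rewrite lerD2r dformDZl // !dformDZr // [dform w _ f]dformC -/a -/b; lra.
have k0 : 0 < `|a| + 1 by rewrite ltr_wpDl.
(* The denominator is positive even when [a = 0], and at this [t] the quadratic is negative unless
   [b = 0]. *)
have := H (- b / (`|a| + 1)).
have -> : 2 * (- b / (`|a| + 1)) * b + (- b / (`|a| + 1)) ^+ 2 * a
   = - (b ^+ 2 * (2 * (`|a| + 1) - a) / (`|a| + 1) ^+ 2).
  by field; rewrite gt_eqF.
rewrite oppr_ge0 pmulr_lle0 ?invr_gt0 ?exprn_gt0 // pmulr_lle0; last first.
  by have := ler_norm a; lra.
by move=> b0; apply/eqP; rewrite -sqrf_eq0 eq_le b0 sqr_ge0.
Qed.

End Realizations.


(** * Functions and realizations on the contraction *)

Section ContractionForm.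
Context {R : realType} {N : nat} (X : zgraph N) (v0 v1 : vert X).
Let Xhat := contraction v0 v1.

Definition pull {T} (F : vert Xhat -> T) : vert X -> T := F \o cproj v0 v1.

Lemma pull_realization rho (F : vert Xhat -> 'cV[R]_N) :
  realization rho F -> realization rho (pull F).
Proof.
move=> [hrho FE]; split=> // a x.
by rewrite /pull /= -cactV_proj -FE.
Qed.

Lemma pull_glued {T} (F : vert Xhat -> T) : pull F v1 = pull F v0.
Proof.
rewrite /pull /=; congr F; apply/clsP/rst_sym/rst_step.
by exists 0; rewrite !actV0.
Qed.

(** By invariance [f] also agrees on all translates of [v0] and [v1], so it is constant on glued
    classes and can be read off at representatives. *)
Lemma descend (f : vert X -> R) : invariant f -> f v0 = f v1 ->
  exists g : vert Xhat -> R, invariant g /\ f = pull g.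
Proof.
move=> fI f01; have repE x : f (rep (cproj v0 v1 x)) = f x.
  have: clos_refl_sym_trans (vert X) (Defs.glue v0 v1) (rep (cproj v0 v1 x)) x.
    by apply/clsP; rewrite repK.
  move: (rep _) => y; elim=> {x y} [y z [a [-> ->]]|y|y z _ ->|y z t _ -> _ ->] //.
  by rewrite !fI.
exists (fun q => f (rep q)); split; last by apply/funext => x; rewrite /pull /= repE.
by move=> a q; rewrite /= /cactV repE fI.
Qed.

(** Contraction keeps edges and their orbits, and a function has the same gradient as its pullback,
    so the two Dirichlet forms agree by conversion. *)
Lemma harmonic_pull_dform (w : edge X -> R) rho (Phi : vert Xhat -> 'cV[R]_N) f i :
  finite_set [set: eorb X] -> harmonic Xhat w rho Phi ->
  invariant f -> f v0 = f v1 ->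
  dform w f (component (pull Phi) i) = 0.
Proof.
move=> finE Phih fI /(descend fI) [g [gI ->]].
exact: (harmonic_dform (X := Xhat) finE i Phih gI).
Qed.

End ContractionForm.

(** * Dependence on the weight of [e010] *)

Theorem theorem7p2 (R : realType) (N : nat) (hN : (1 <= N)%N)
  (X : zgraph N) (w0 : edge X -> R) (hX : periodic_graph X w0)
  (n : nat) (hn : (1 <= n)%N) (v : 'I_n.+1 -> vert X)
  (hv : bijective (fun i => vcls (v i)))
  (e010 : edge X) (ho : orig e010 = v ord0) (ht : term e010 = v (inord 1)) :
  exists W : R,
  forall rho : {additive 'cV[int]_N -> 'cV[R]_N}, period_hom rho ->
  exists z : 'cV[R]_N,
  forall w : edge X -> R,
    is_weight X w ->
    (forall e, ecls e <> ecls e010 -> ecls e <> ecls (einv e010) -> w e = w0 e) ->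
    graph_connected X w ->
  forall (Phi : vert X -> 'cV[R]_N)
         (Phihat : vert (contraction (v ord0) (v (inord 1))) -> 'cV[R]_N),
    harmonic X w rho Phi -> Phi (v ord0) = 0 ->
    harmonic (contraction (v ord0) (v (inord 1))) w rho Phihat ->
    Phihat (cproj (v ord0) (v (inord 1)) (v ord0)) = 0 ->
  [/\ w e010 + W != 0,
      edge_vec Phi e010 = (w e010 + W)^-1 *: z,
      tension (contraction (v ord0) (v (inord 1))) w Phihat - tension X w Phi
        = (w e010 + W)^-1 *: tensor2 z,
      energy (contraction (v ord0) (v (inord 1))) w Phihat - energy X w Phi
        = sqnorm z / (w e010 + W)
    & sqnorm z / (w e010 + W) = (w e010 + W) * sqnorm (edge_vec Phi e010)].
Proof.
have [w0W _ w0C [eV _] [_ finE]] := hX.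
set v0 := v ord0; set v1 := v (inord 1).
have gradE f : grad f e010 = f v1 - f v0 by rewrite /grad ho ht.
have v01 : vcls v0 <> vcls v1.
  move=> /(bij_inj hv) /(congr1 val) /=.
  by rewrite inordK.
have [u' [u'I u'P]] := poisson finE w0W w0C hv v0 v1.
(* Otherwise [u'] has zero energy and is constant, and testing with the indicator of the orbit of
   [v1] gives 0 = 1. *)
have u'0 : grad u' e010 != 0.
  apply/eqP => u'0.
  have u'c : forall x y, u' x = u' y.
    apply: (dform_eq0_const finE w0W w0C (invariant_equivariant u'I)).
    by rewrite u'P // -gradE.
  pose f x : R := (vcls x == vcls v1)%:R.
  have fI : invariant f by move=> a x; rewrite /f vcls_act.
  have := u'P f fI; rewrite /dform fsbig_finite //= big1 ?mulr0; last first.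
    by move=> q _; rewrite /grad (u'c (term _) (orig (erep q))) subrr mul0r mulr0.
  rewrite /f eqxx; case: eqP => // _; rewrite subr0 => /esym/eqP.
  by rewrite oner_eq0.
pose c := (grad u' e010)^-1.
(* The summand 0 puts u in the form to which dformDZl applies. *)
pose u x := 0 + c * u' x.
have uI : invariant u by move=> a x; rewrite /u u'I.
have uE := invariant_equivariant uI.
have gu : grad u e010 = 1.
  by rewrite /u /grad !add0r -mulrBr -[_ - _]/(grad u' e010) mulVf.
have dform_u f : invariant f -> dform w0 u f = c * grad f e010.
  move=> fI; rewrite dformDZl // u'P // -gradE [X in X + _]/dform.
  rewrite fsbig_finite //= big1 ?mulr0 ?add0r // => q _.
  by rewrite /grad subrr mul0r mulr0.
exists (c - w0 e010) => rho hrho.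
(* The vector [z] must be fixed before [w] and [Phi], so it is computed from an arbitrary
   realization; if there is none, the claim is vacuous. *)
have [[Theta ThetaR]|noR] :=
    pselect (exists Theta : vert X -> 'cV[R]_N, realization rho Theta);
  last first.
  by exists 0 => w _ _ _ Phi Phihat [PhiR _]; case: noR; exists Phi.
(* Passing from w' to [w0] in the form adds [w0 e010] times the gradient, which turns the
   coefficient W into [c]. *)
exists (\col_i (c * grad (component Theta i) e010 - dform w0 u (component Theta i))).
set z := \col_i _ => w wW ww0 wC Phi Phihat Phih _ Phihath _.
pose Psi := pull Phihat.
have PhiR : realization rho Phi by case: Phih.
have PsiR : realization rho Psi by apply: pull_realization; case: Phihath.
have dform_w f : equivariant f ->
    dform w u f = dform w0 u f + (w e010 - w0 e010) * grad f e010.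
  move=> fE; rewrite (dform_change_weight finE wW w0W uE fE (eV e010) ww0).
  by rewrite gu mul1r.
set s := w e010 + (c - w0 e010).
have dform_wu f : invariant f -> dform w u f = s * grad f e010.
  move=> fI; rewrite dform_w ?dform_u //; last exact: invariant_equivariant.
  by rewrite /s; ring.
(* If [s = 0], then [u] has zero energy for [w] and is constant, against [gu]. *)
have s0 : s != 0.
  apply/eqP => s0; have := oner_eq0 R; rewrite -gu gradE.
  rewrite (dform_eq0_const finE wW wC uE _ v1 v0) ?subrr ?eqxx //.
  by rewrite dform_wu // s0 mul0r.
have diffI (F : vert X -> 'cV[R]_N) i : realization rho F ->
    invariant (fun x => component F i x + -1 * component Phi i x).
  move=> [_ FE] a x; rewrite /component FE; case: PhiR => _ ->.
  by rewrite !mxE; ring.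
(* The functional defining [z] vanishes on invariant functions by [dform_u], so [Theta] may be
   replaced by [Phi], to which [u] is orthogonal for [w]. *)
have zP i : z i 0 = s * grad (component Phi i) e010.
  have := dform_u _ (diffI _ i ThetaR).
  rewrite dformDZr // mxE.
  have := harmonic_dform finE i Phih uI.
  rewrite dform_w; last exact: component_equivariant PhiR.
  by rewrite /s /grad => H1 H2; lra.
have Psi0 i : grad (component Psi i) e010 = 0.
  by rewrite gradE /component /Psi (pull_glued Phihat) subrr.
pose D i x := component Psi i x + -1 * component Phi i x.
have DI i : invariant (D i) := diffI _ i PsiR.
have gD i : grad (D i) e010 = - (s^-1 * z i 0).
  rewrite zP mulKf // -[RHS]add0r -(Psi0 i) /D /grad; ring.
have dformD f i : invariant f -> f v0 = f v1 -> dform w f (D i) = 0.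
  move=> fI f01; rewrite dformDZr // (harmonic_dform finE i Phih fI).
  by rewrite (harmonic_pull_dform i finE Phihath fI f01) mulr0 addr0.
have dformDD i j : dform w (D i) (D j) = s^-1 * (z i 0 * z j 0).
  (* Since [u] has gradient 1 along [e010], subtracting this multiple of it makes the values at [v0]
     and [v1] equal, as [dformD] requires. *)
  have : dform w (fun x => D i x + - grad (D i) e010 * u x) (D j) = 0.
    apply: dformD.
      by move=> a x; rewrite DI uI.
    have := gu; rewrite !gradE => gu'.
    by rewrite -[u v1](subrK (u v0)) gu'; ring.
  rewrite dformDZl // dform_wu // !gD => /eqP; rewrite addr_eq0 => /eqP ->.
  by field.
have PsiE k : component Psi k = fun x => component Phi k x + 1 * D k x.
  by apply/funext => x; rewrite /D; ring.
clearbody D.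
have tenE : tension (contraction v0 v1) w Phihat - tension X w Phi
    = s^-1 *: tensor2 z.
  apply/matrixP => i j; rewrite [LHS]mxE [X in _ + X]mxE [RHS]mxE tensor2E -dformDD.
  rewrite -[tension _ _ Phihat]/(tension X w Psi) !tensionE //.
  rewrite !PsiE dformDZl // !dformDZr // [dform w (component Phi i) (D j)]dformC.
  by rewrite (harmonic_dform finE j Phih (DI i))
    (harmonic_dform finE i Phih (DI j)); ring.
have vecE : edge_vec Phi e010 = s^-1 *: z.
  by apply/matrixP => i j; rewrite ord1 [RHS]mxE zP grad_component mulKf.
(* Energy is the trace of tension, so this is the trace of [tenE]. *)
have trE : energy (contraction v0 v1) w Phihat - energy X w Phi
    = sqnorm z / s.
  rewrite -[energy _ _ Phihat]/(energy X w Psi) !energyE // -sumrB.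
  rewrite sqnorm_tensor2 mulrC -mxtraceZ -tenE; apply: eq_bigr => i _.
  rewrite [RHS]mxE [X in _ = _ + X]mxE.
  by rewrite -[tension _ _ Phihat]/(tension X w Psi) !tensionE.
split=> //.
rewrite vecE; clearbody z; rewrite /sqnorm mulr_suml mulr_sumr.
by apply: eq_bigr => i _; rewrite mxE; field.
Qed.
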